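(* Let $\mathbb U,\mathbb V$ be nontrivial real Hilbert spaces, let $b:\mathbb U\times\mathbb V\to\mathbb R$ be a bilinear form satisfying the continuity, injectivity and surjectivity conditions given in the context, let $\ell:\mathbb V\to\mathbb R$ be a continuous linear functional, and let $u^*\in\mathbb U$ be the unique element with $b(u^*,v)=\ell(v)$ for all $v\in\mathbb V$. Let $B:\mathbb U\to\mathbb V$ and $B':\mathbb V\to\mathbb U$ be the operators associated with $b$, and, for $\rho>0$ and an initial guess $u^0\in\mathbb U$, let $\{u^k\}$ be the Uzawa sequence (all defined in the context). Then: 1. If $0<\rho<2\|B\|^{-2}$, the operator $I-\rho B'B:\mathbb U\to\mathbb U$ is a contraction, i.e. $\|I-\rho B'B\|<1$; hence $u^k\to u^*$ in $\mathbb U$. 2. The optimal choice of $\rho$ (the one minimizing $\|I-\rho B'B\|$ over $\rho>0$) is $$\rho^*:=\frac{2}{\|B\|^2+\|B^{-1}\|^{-2}},$$ with optimal contraction rate $$\|I-\rho^*B'B\|=\frac{\|B\|^2-\|B^{-1}\|^{-2}}{\|B\|^2+\|B^{-1}\|^{-2}}.$$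
   Context: $\mathbb U$ and $\mathbb V$ carry inner products $(\cdot,\cdot)_{\mathbb U}$, $(\cdot,\cdot)_{\mathbb V}$ with induced norms $\|\cdot\|_{\mathbb U}$, $\|\cdot\|_{\mathbb V}$; $\|\cdot\|$ on operators is the operator norm and $I$ is the identity. Conditions on $b$: - Continuity: there is $M>0$ with $\sup_{v\in\mathbb V\setminus\{0\}}\frac{|b(u,v)|}{\|v\|_{\mathbb V}}\le M\|u\|_{\mathbb U}$ for all $u\in\mathbb U$. - Injectivity: there is $\gamma_1>0$ with $\sup_{v\in\mathbb V\setminus\{0\}}\frac{|b(u,v)|}{\|v\|_{\mathbb V}}\ge\gamma_1\|u\|_{\mathbb U}$ for all $u\in\mathbb U$. - Surjectivity: there is $\gamma_2>0$ with $\sup_{u\in\mathbb U\setminus\{0\}}\frac{|b(u,v)|}{\|u\|_{\mathbb U}}\ge\gamma_2\|v\|_{\mathbb V}$ for all $v\in\mathbb V$. Under these conditions the problem defining $u^*$ has a unique solution. The bounded operators $B:\mathbb U\to\mathbb V$ and $B':\mathbb V\to\mathbb U$ are defined by $(Bu,v)_{\mathbb V}=b(u,v)=(u,B'v)_{\mathbb U}$ for all $u\in\mathbb U$, $v\in\mathbb V$; $B$ is boundedly invertible. Uzawa sequence: given $u^0\in\mathbb U$ and a step size $\rho>0$, $u^{k+1}=u^k+\rho\delta^k$ for $k\ge0$, where $r^k\in\mathbb V$ is the unique element with $(r^k,v)_{\mathbb V}=\ell(v)-b(u^k,v)$ for all $v\in\mathbb V$, and $\delta^k\in\mathbb U$ is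 the unique element with $(\delta^k,w)_{\mathbb U}=b(w,r^k)$ for all $w\in\mathbb U$. *)

(* Defs.v *)
From HB Require Import structures.
From mathcomp Require Import all_boot all_order all_algebra.
From mathcomp Require Import all_classical all_reals all_analysis.

Set Implicit Arguments.
Unset Strict Implicit.
Unset Printing Implicit Defensive.

Import Order.TTheory GRing.Theory Num.Theory.
Import numFieldNormedType.Exports.

Local Open Scope classical_set_scope.
Local Open Scope ring_scope.

HB.mixin Record isHilbert (R : realType) (V : Type)
    & CompleteNormedModule R V := {
  inner : {dot V for (@idfun R)};
  norm_inner : forall x : V, `|x| = Num.sqrt (inner x x)
}.

#[short(type="hilbertType")]
HB.structure Definition Hilbert (R : realType) :=
  {V of CompleteNormedModule R V & isHilbert R V}.

Arguments inner {R V} : rename.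

(* Extended-real valued, hence +oo on unbounded maps. The domain has to be
   nontrivial: the supremum over the empty set is -oo. *)
Definition opnorm (R : realType) (V W : normedModType R) (f : V -> W) : \bar R :=
  ereal_sup [set (`|f x| / `|x|)%:E | x in [set x | x != 0]].

Section BilinearForm.
Context (R : realType) (U V : hilbertType R).
Implicit Type b : {bilinear U -> V -> R | *%R & *%R}.

Definition form_continuous b := exists2 M : R, 0 < M &
  forall u : U,
    (ereal_sup [set (`|b u v| / `|v|)%:E | v in [set v : V | v != 0%R]]
      <= (M * `|u|)%:E)%E.

Definition form_injective b := exists2 gamma1 : R, 0 < gamma1 &
  forall u : U,
    ((gamma1 * `|u|)%:E
      <= ereal_sup [set (`|b u v| / `|v|)%:E | v in [set v : V | v != 0%R]])%E.

Definition form_surjective b := exists2 gamma2 : R, 0 < gamma2 &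
  forall v : V,
    ((gamma2 * `|v|)%:E
      <= ereal_sup [set (`|b u v| / `|u|)%:E | u in [set u : U | u != 0%R]])%E.

(* The representing vectors are unique because the inner products are definite,
   so these relations determine B, B', the residuals r k and the
   directions delta k. *)
Definition form_operator b (B : U -> V) :=
  forall u v, inner (B u) v = b u v.

Definition form_adjoint_operator b (B' : V -> U) :=
  forall u v, b u v = inner u (B' v).

Definition uzawa_sequence b (l : V -> R) (rho : R) (u0 : U) (u : U ^nat) :=
  u 0%N = u0 /\
  exists (r : V ^nat) (delta : U ^nat), forall k : nat,
    [/\ forall v, inner (r k) v = l v - b (u k) v,
        forall w, inner (delta k) w = b w (r k)
      & u k.+1 = u k + rho *: delta k].

End BilinearForm.

(* The two-sided inverse when B is bijective, which the three conditions above
   guarantee for the operator of b; the default 0 is used off the range of B. *)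
Definition inverse (U V : zmodType) (B : U -> V) : V -> U :=
  'pinv_(fun=> 0) [set: U] B.

Definition uzawa_operator (R : realType) (U V : hilbertType R)
    (B : U -> V) (B' : V -> U) (rho : R) : U -> U :=
  fun u => u - rho *: B' (B u).

Definition minimizes_over_pos (R : realType) (f : R -> \bar R) (rho : R) :=
  0 < rho /\ forall rho' : R, 0 < rho' -> (f rho <= f rho')%E.

(* Main.v *)
(* T = I - rho B'B is symmetric with (T u, u) = |u|^2 - rho |B u|^2, and the norm
   of a symmetric operator is the supremum of |(T u, u)| / |u|^2. Writing M = ||B||
   and m = ||B^-1||^-1, the quotient |B u| / |u| has supremum M and infimum m, so
   ||T|| = max (1 - rho m^2) (rho M^2 - 1). This piecewise affine function of rho
   decreases, then increases, with its kink at rho = 2 / (M^2 + m^2). The error of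
   the Uzawa iteration obeys u^(k+1) - u* = T (u^k - u* ). *)
Require Import Defs.
From HB Require Import structures.
From mathcomp Require Import all_boot all_order all_algebra.
From mathcomp Require Import all_classical all_reals all_analysis.
From mathcomp Require Import ring lra.

Import Order.TTheory GRing.Theory Num.Theory.
Import numFieldNormedType.Exports.

Local Open Scope classical_set_scope.
Local Open Scope ring_scope.

(** * Inner product identities and norms of symmetric maps *)

Section InnerProduct.
Context {R : realType} {V : hilbertType R}.
Implicit Types x y z : V.

Lemma innerC x y : inner x y = inner y x.
Proof. by rewrite hermC expr0 mul1r. Qed.

Lemma innerDl x y z : inner (x + y) z = inner x z + inner y z.
Proof. exact: linearDl. Qed.

Lemma innerBl x y z : inner (x - y) z = inner x z - inner y z.
Proof. exact: linearBl. Qed.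

Lemma innerZl a x z : inner (a *: x) z = a * inner x z.
Proof. exact: linearZl_LR. Qed.

Lemma innerDr x y z : inner z (x + y) = inner z x + inner z y.
Proof. by rewrite innerC innerDl !(innerC z). Qed.

Lemma innerBr x y z : inner z (x - y) = inner z x - inner z y.
Proof. by rewrite innerC innerBl !(innerC z). Qed.

Lemma innerZr a x z : inner z (a *: x) = a * inner z x.
Proof. by rewrite innerC innerZl (innerC z). Qed.

Lemma innerxx x : inner x x = `|x| ^+ 2.
Proof.
rewrite norm_inner sqr_sqrtr//.
have [->|x0] := eqVneq x 0; last exact/ltW/neq0_dnorm_gt0.
by rewrite linear0l.
Qed.

(** Turns the weak relations defining [B], [B'], the residuals and the directions into equations
    between vectors. *)
Lemma inner_inj x y : (forall z, inner x z = inner y z) -> x = y.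
Proof.
move=> xy; apply/eqP; rewrite -subr_eq0 -normr_eq0 -sqrf_eq0 -innerxx.
by rewrite innerBl xy subrr.
Qed.

(** Cauchy-Schwarz: expand the square of the norm of |y| x - |x| y and cancel |x| |y|, which is
    positive once both vectors are nonzero. *)
Lemma inner_le_norm x y : inner x y <= `|x| * `|y|.
Proof.
have [->|x0] := eqVneq x 0; first by rewrite linear0l normr0 mul0r.
have [->|y0] := eqVneq y 0.
  by rewrite innerC linear0l normr0 mulr0.
have xy0 : 0 < `|x| * `|y| by rewrite mulr_gt0 ?normr_gt0.
have := sqr_ge0 `| `|y| *: x - `|x| *: y |.
rewrite -innerxx !innerBl !innerBr !innerZl !innerZr !innerxx (innerC y x).
rewrite -(ler_pM2l xy0).
move: (inner x y) => s; lra.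
Qed.

Lemma normr_inner_le x y : `|inner x y| <= `|x| * `|y|.
Proof.
rewrite ler_norml inner_le_norm andbT lerNl.
have := inner_le_norm (-1 *: x) y.
by rewrite innerZl mulN1r scaleN1r normrN.
Qed.

(* Polarization: 4 (T x, y) is the difference of the quadratic form at x + y
   and x - y. The step y = (|x| / |T x|) T x balances the two norms. *)
Lemma symmetric_norm_le (T : V -> V) (c : R) :
  (forall x y, inner (T x) y = inner x (T y)) ->
  (forall x, `|inner (T x) x| <= c * `|x| ^+ 2) ->
  forall x, `|T x| <= c * `|x|.
Proof.
move=> Tsym Tc x.
have polar y : 2 * inner (T x) y <= c * (`|x| ^+ 2 + `|y| ^+ 2).
  have TC : inner (T y) x = inner (T x) y by rewrite Tsym innerC.
  (* Symmetry stands in for additivity of [T]: it moves [T] to the other argument, so that the sum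
     can be split by the inner product. *)
  have TD : inner (T (x + y)) (x + y) =
      inner (T x) x + inner (T y) y + 2 * inner (T x) y.
    by rewrite Tsym innerDl -!Tsym !innerDr TC; ring.
  have TB : inner (T (x - y)) (x - y) =
      inner (T x) x + inner (T y) y - 2 * inner (T x) y.
    by rewrite Tsym innerBl -!Tsym !innerBr TC; ring.
  have := Tc (x - y); have := Tc (x + y).
  rewrite !ler_norml TD TB -!innerxx.
  rewrite innerBl !innerBr innerDl !innerDr (innerC y x) !innerxx.
  lra.
have [->|x0] := eqVneq x 0.
  have -> : T 0 = 0 by apply: inner_inj => z; rewrite Tsym !linear0l.
  by rewrite normr0 mulr0.
have [->|Tx0] := eqVneq (T x) 0.
  have := Tc x; rewrite normr0 => /(le_trans (normr_ge0 _)).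
  by rewrite expr2 mulrA pmulr_lge0 // normr_gt0.
have := polar ((`|x| / `|T x|) *: T x).
rewrite innerZr innerxx normrZ normrM normfV !normr_id.
have nx : 0 < `|x| by rewrite normr_gt0.
have nT : 0 < `|T x| by rewrite normr_gt0.
rewrite expr2 -(mulrA `|x|) !(mulKf (lt0r_neq0 nT)) divfK ?lt0r_neq0// => h.
by rewrite -(ler_pM2l nx); lra.
Qed.

End InnerProduct.

(** * Real bounds and the extended-real operator norm *)

Section OperatorNorm.
Context {R : realType} {V W : normedModType R}.
Variable f : V -> W.

Lemma opnorm_le (c : R) :
  (forall x, x != 0 -> `|f x| <= c * `|x|) -> (opnorm f <= c%:E)%E.
Proof.
move=> fc; apply: ge_ereal_sup => _ [x /= x0 <-].
by rewrite lee_fin ler_pdivrMr ?normr_gt0// fc.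
Qed.

Lemma ratio_le_opnorm {x} : x != 0 -> ((`|f x| / `|x|)%:E <= opnorm f)%E.
Proof. by move=> x0; apply: ereal_sup_ubound; exists x. Qed.

(** The nonzero vector excludes -oo, the bound excludes +oo. *)
Lemma opnorm_fin_num (c : R) : (exists x : V, x != 0) ->
  (forall x, x != 0 -> `|f x| <= c * `|x|) -> opnorm f \is a fin_num.
Proof.
move=> [x x0] /opnorm_le fc; rewrite fin_numE.
have := ratio_le_opnorm x0.
by case: (opnorm f) fc.
Qed.

Lemma norm_le_opnorm x : opnorm f \is a fin_num -> x != 0 ->
  `|f x| <= fine (opnorm f) * `|x|.
Proof.
move=> ffin x0; rewrite -ler_pdivrMr ?normr_gt0// -lee_fin fineK//.
exact: ratio_le_opnorm.
Qed.

Lemma fine_opnorm_le (c : R) : (exists x : V, x != 0) ->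
  (forall x, x != 0 -> `|f x| <= c * `|x|) -> fine (opnorm f) <= c.
Proof.
move=> V0 fc; rewrite -lee_fin fineK; first exact: opnorm_le.
exact: opnorm_fin_num V0 fc.
Qed.

End OperatorNorm.

(** * The inverse and the constant m = ||B^-1||^-1 *)

Section Inverse.
Context {U V : zmodType}.
Variable B : U -> V.

Lemma inverseK : injective B -> cancel B (inverse B).
Proof. by move=> Binj u; apply: pinvKV; rewrite ?in_setT// => x y _ _ /Binj. Qed.

Lemma inverse_out v : ~ range B v -> inverse B v = 0.
Proof. by rewrite /inverse /pinv_ splitV oinv_surj; case: pselect. Qed.

End Inverse.

Section InverseNorm.
Context {R : realType} {U V : normedModType R}.
Variable B : U -> V.
Hypothesis Binj : injective B.

(** On the range this is the lower bound read at the preimage; off the range the default value 0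
    satisfies it. *)
Lemma inverse_norm_le (c : R) : 0 < c ->
  (forall u, c * `|u| <= `|B u|) -> forall v, `|inverse B v| <= c^-1 * `|v|.
Proof.
move=> c0 cB v; have [[u _ <-]|Bv] := pselect (range B v).
  by rewrite inverseK// ler_pdivlMl.
by rewrite inverse_out// normr0 mulr_ge0// invr_ge0 ltW.
Qed.

Hypothesis U0 : exists u : U, u != 0.
Hypothesis V0 : exists v : V, v != 0.
Hypothesis B_lower : exists2 c, 0 < c & forall u, c * `|u| <= `|B u|.

Local Notation m := (fine (opnorm (inverse B)))^-1.

Lemma norm_inverse_opnorm u : `|u| <= fine (opnorm (inverse B)) * `|B u|.
Proof.
have [c c0 cB] := B_lower.
have [->|u0] := eqVneq u 0.
  (* [B 0] is not known to vanish here, so the norm of the inverse must be shown nonnegative; any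
     ratio at a nonzero vector of [V] does this. *)
  rewrite normr0 mulr_ge0// fine_ge0//; have [v v0] := V0.
  apply: le_trans (ratio_le_opnorm _ v0).
  by rewrite lee_fin divr_ge0.
have Bu0 : B u != 0.
  rewrite -normr_gt0; apply: lt_le_trans (cB u).
  by rewrite mulr_gt0// normr_gt0.
rewrite -{1}(inverseK B Binj u); apply: norm_le_opnorm => //.
by apply: (opnorm_fin_num _ c^-1) => // v _; exact: inverse_norm_le.
Qed.

Lemma opnorm_inverse_gt0 : 0 < fine (opnorm (inverse B)).
Proof.
have [u u0] := U0; have := norm_inverse_opnorm u.
rewrite leNgt => /negP h; rewrite ltNge; apply/negP => K0; apply: h.
apply: (@le_lt_trans _ _ 0); last by rewrite normr_gt0.
by rewrite mulr_le0_ge0.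
Qed.

Lemma opnorm_inverse_lower u : m * `|u| <= `|B u|.
Proof.
by rewrite ler_pdivrMl ?opnorm_inverse_gt0//; exact: norm_inverse_opnorm.
Qed.

(** With [opnorm_inverse_lower], this identifies m as the infimum of |B u| / |u|: a lower constant c
    for [B] bounds the inverse by 1/c. *)
Lemma opnorm_inverse_greatest (c : R) : 0 < c ->
  (forall u, c * `|u| <= `|B u|) -> c <= m.
Proof.
move=> c0 cB; rewrite -[c]invrK lef_pV2 ?posrE ?invr_gt0 ?opnorm_inverse_gt0//.
by apply: fine_opnorm_le => // v _; exact: inverse_norm_le.
Qed.

End InverseNorm.

(** * The exact norm of I - rho B'B from the extremal constants of B *)

Section GradientStep.
Context {R : realType} {U V : hilbertType R}.
Variables (B : U -> V) (M m : R).
Hypothesis U0 : exists u : U, u != 0.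
Hypotheses (M0 : 0 < M) (m0 : 0 < m).
Hypothesis M_upper : forall u, `|B u| <= M * `|u|.
Hypothesis M_least : forall c,
  (forall u, u != 0 -> `|B u| <= c * `|u|) -> M <= c.
Hypothesis m_lower : forall u, m * `|u| <= `|B u|.
Hypothesis m_greatest : forall c, 0 < c ->
  (forall u, c * `|u| <= `|B u|) -> c <= m.

Lemma lower_le_upper : m <= M.
Proof.
have [u u0] := U0; have := le_trans (m_lower u) (M_upper u).
by rewrite ler_pM2r// normr_gt0.
Qed.

Variables (rho : R) (T : U -> U).
Hypothesis rho0 : 0 < rho.
(** This weak form of I - rho B'B yields both the symmetry of [T] and its quadratic form. *)
Hypothesis TE : forall x y, inner (T x) y = inner x y - rho * inner (B x) (B y).

Let r := Num.max (1 - rho * m ^+ 2) (rho * M ^+ 2 - 1).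

(** The quadratic form of [T] lies between (1 - rho M^2) |x|^2 and (1 - rho m^2) |x|^2, hence
    between -r |x|^2 and r |x|^2. *)
Lemma gradient_step_norm_le u : `|T u| <= r * `|u|.
Proof.
apply: symmetric_norm_le => [x y|x].
  by rewrite (innerC x) !TE (innerC x) (innerC (B x)).
rewrite TE !innerxx ler_norml.
have Bup : `|B x| ^+ 2 <= M ^+ 2 * `|x| ^+ 2.
  by rewrite -exprMn lerXn2r// nnegrE// mulr_ge0// ltW.
have Blo : m ^+ 2 * `|x| ^+ 2 <= `|B x| ^+ 2.
  by rewrite -exprMn lerXn2r// nnegrE// mulr_ge0// ltW.
have rm : (1 - rho * m ^+ 2) * `|x| ^+ 2 <= r * `|x| ^+ 2.
  by rewrite ler_wpM2r ?sqr_ge0// le_max lexx.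
have rM : (rho * M ^+ 2 - 1) * `|x| ^+ 2 <= r * `|x| ^+ 2.
  by rewrite ler_wpM2r ?sqr_ge0// le_max lexx orbT.
move: Bup; rewrite -(ler_pM2l rho0) => Bup.
move: Blo; rewrite -(ler_pM2l rho0) => Blo.
by apply/andP; split; lra.
Qed.

(** A bound N on [T] restricts its quadratic form, which makes sqrt((1 - N) / rho) a lower constant
    and sqrt((1 + N) / rho) an upper constant for [B]. Extremality of m and M then bounds each
    branch of r by N. *)
Lemma gradient_step_norm_ge (N : R) :
  (forall u, u != 0 -> `|T u| <= N * `|u|) -> r <= N.
Proof.
move=> TN.
have quad u : u != 0 -> `| `|u| ^+ 2 - rho * `|B u| ^+ 2 | <= N * `|u| ^+ 2.
  move=> u0; rewrite -!innerxx -TE; apply: le_trans (normr_inner_le _ _) _.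
  by rewrite innerxx expr2 mulrA ler_wpM2r// TN.
have N0 : 0 <= N.
  have [u u0] := U0; have := le_trans (normr_ge0 _) (TN _ u0).
  by rewrite pmulr_lge0// normr_gt0.
rewrite /r ge_max; apply/andP; split.
  (* For N >= 1 the branch 1 - rho m^2 is below N at once; otherwise the radicand is positive, as
     [m_greatest] demands. *)
  have [N1|N1] := leP 1 N.
    by have := mulr_ge0 (ltW rho0) (sqr_ge0 m); lra.
  have s0 : 0 < (1 - N) / rho by rewrite divr_gt0// subr_gt0.
  have : Num.sqrt ((1 - N) / rho) <= m.
    apply: m_greatest => [|u]; first by rewrite sqrtr_gt0.
    have [->|u0] := eqVneq u 0; first by rewrite normr0 mulr0.
    rewrite -(@ler_pXn2r _ 2)// ?nnegrE ?mulr_ge0 ?sqrtr_ge0//.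
    rewrite exprMn sqr_sqrtr ?(ltW s0)// mulrAC ler_pdivrMr//.
    have := quad _ u0; rewrite ler_norml; lra.
  rewrite -(@ler_pXn2r _ 2)// ?nnegrE ?sqrtr_ge0 ?(ltW m0)//.
  rewrite sqr_sqrtr ?(ltW s0)// ler_pdivrMr//; lra.
have s0 : 0 < (1 + N) / rho by rewrite divr_gt0// ltr_pwDl.
have : M <= Num.sqrt ((1 + N) / rho).
  apply: M_least => u u0.
  rewrite -(@ler_pXn2r _ 2)// ?nnegrE ?mulr_ge0 ?sqrtr_ge0//.
  rewrite exprMn sqr_sqrtr ?(ltW s0)// mulrAC ler_pdivlMr//.
  have := quad _ u0; rewrite ler_norml; lra.
rewrite -(@ler_pXn2r _ 2)// ?nnegrE ?sqrtr_ge0 ?(ltW M0)//.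
rewrite sqr_sqrtr ?(ltW s0)// ler_pdivlMr//; lra.
Qed.

Lemma opnorm_gradient_step : opnorm T = r%:E.
Proof.
have Tr u : u != 0 -> `|T u| <= r * `|u| by move=> _; exact: gradient_step_norm_le.
have Tfin := opnorm_fin_num T r U0 Tr.
rewrite -(fineK Tfin); congr _%:E; apply/le_anti/andP; split.
  exact: fine_opnorm_le.
by apply: gradient_step_norm_ge => u; exact: norm_le_opnorm.
Qed.

End GradientStep.

(** * Minimizing the piecewise affine rate *)

Section OptimalStep.
Context {R : realType} (M m : R).
Hypotheses (m0 : 0 < m) (mM : m <= M).

Let rate rho := Num.max (1 - rho * m ^+ 2) (rho * M ^+ 2 - 1).
Let rhostar := 2 / (M ^+ 2 + m ^+ 2).

Let m20 : 0 < m ^+ 2. Proof. by rewrite exprn_gt0. Qed.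
Let M20 : 0 < M ^+ 2. Proof. by rewrite exprn_gt0// (lt_le_trans m0). Qed.
Let S0 : 0 < M ^+ 2 + m ^+ 2. Proof. exact: addr_gt0. Qed.

Lemma rate_lt1 rho : 0 < rho -> rho < 2 * M ^- 2 -> rate rho < 1.
Proof.
move=> rho0; rewrite ltr_pdivlMr// => rhoM.
by rewrite gt_max; have := mulr_gt0 rho0 m20; lra.
Qed.

Lemma rhostar_gt0 : 0 < rhostar.
Proof. exact: divr_gt0. Qed.

(* Both branches of the maximum agree at rhostar. *)
Lemma rate_rhostar : rate rhostar = (M ^+ 2 - m ^+ 2) / (M ^+ 2 + m ^+ 2).
Proof.
have Sn0 := lt0r_neq0 S0.
rewrite /rate; have -> : rhostar * M ^+ 2 - 1 = 1 - rhostar * m ^+ 2.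
  by rewrite /rhostar; field.
by rewrite maxxx /rhostar; field.
Qed.

(** To the left of the kink the decreasing branch already exceeds the common value, to the right the
    increasing one does. Strictness gives uniqueness of the optimal step. *)
Lemma rate_rhostar_lt rho : rho != rhostar -> rate rhostar < rate rho.
Proof.
have Sn0 := lt0r_neq0 S0.
have e1 : rate rhostar = 1 - rhostar * m ^+ 2.
  by rewrite rate_rhostar /rhostar; field.
have e2 : rate rhostar = rhostar * M ^+ 2 - 1.
  by rewrite rate_rhostar /rhostar; field.
rewrite neq_lt lt_max => /orP[h|h]; apply/orP; [left|right].
  by rewrite e1 ltrD2l ltrN2 ltr_pM2r.
by rewrite e2 ltrD2r ltr_pM2r.
Qed.

End OptimalStep.

(** * From the form to its operators and the Uzawa error *)

Section FormOperator.
Context {R : realType} {U V : hilbertType R}.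
Variables (b : {bilinear U -> V -> R | *%R & *%R}) (B : U -> V) (B' : V -> U).
Hypotheses (BP : form_operator b B) (B'P : form_adjoint_operator b B').

Lemma form_operatorB : {morph B : x y / x - y}.
Proof.
by move=> x y; apply: inner_inj => z; rewrite innerBl !BP linearBl.
Qed.

Lemma form_le_norm u v : `|b u v| <= `|B u| * `|v|.
Proof. by rewrite -BP normr_inner_le. Qed.

(** Testing with v = B u makes the quotient equal to |B u|; the case B u = 0 is apart because the
    supremum runs over nonzero v. *)
Lemma form_operator_upper : form_continuous b ->
  exists2 c : R, 0 < c & forall u, `|B u| <= c * `|u|.
Proof.
move=> [c c0 bc]; exists c => // u.
have [->|Bu0] := eqVneq (B u) 0; first by rewrite normr0 mulr_ge0// ltW.
have : ((`|b u (B u)| / `|B u|)%:E <= (c * `|u|)%:E)%E.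
  by apply: le_trans (bc u); apply: ereal_sup_ubound; exists (B u).
by rewrite lee_fin -BP innerxx normrX normr_id expr2 mulfK// normr_eq0.
Qed.

(** By Cauchy-Schwarz every quotient in the supremum is at most |B u|. *)
Lemma form_operator_lower : form_injective b ->
  exists2 c : R, 0 < c & forall u, c * `|u| <= `|B u|.
Proof.
move=> [c c0 bc]; exists c => // u; rewrite -lee_fin.
apply: le_trans (bc u) _; apply: ge_ereal_sup => _ [v /= v0 <-].
by rewrite lee_fin ler_pdivrMr ?normr_gt0// form_le_norm.
Qed.

Lemma inner_uzawa_operator rho x y :
  inner (uzawa_operator B B' rho x) y = inner x y - rho * inner (B x) (B y).
Proof.
by rewrite /uzawa_operator innerBl innerZl (innerC (B' _)) -B'P -BP (innerC (B y)).
Qed.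

Lemma uzawa_error (l : V -> R) (rho : R) (ustar u0 : U) (u : U ^nat) :
  (forall v, b ustar v = l v) -> uzawa_sequence b l rho u0 u ->
  forall k, u k.+1 - ustar = uzawa_operator B B' rho (u k - ustar).
Proof.
move=> ustarP [_ [r [delta step]]] k; have [rP deltaP ->] := step k.
have rE : r k = B (ustar - u k).
  by apply: inner_inj => v; rewrite rP BP linearBl ustarP.
have -> : delta k = B' (r k).
  by apply: inner_inj => w; rewrite deltaP B'P innerC.
(* [B'] is a bare function, so its oddness is recovered from the linearity of [b] in the second
   argument. *)
have B'N v : B' (- v) = - B' v.
  apply: inner_inj => w.
  rewrite innerC -B'P linearNr -(scaleN1r (B' v)) innerZl mulN1r.
  by rewrite (innerC (B' v)) -B'P.
rewrite rE; have -> : B (ustar - u k) = - B (u k - ustar).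
  by rewrite !form_operatorB opprB.
by rewrite B'N scalerN addrAC.
Qed.

End FormOperator.

(** * Geometric decay of the error, and both claims assembled *)

Lemma geometric_cvg0 {R : realType} {V : normedModType R} (e : V ^nat) (q : R) :
  0 <= q -> q < 1 -> (forall k, `|e k.+1| <= q * `|e k|) -> e @ \oo --> 0.
Proof.
move=> q0 q1 eq; apply: norm_cvg0.
have ek k : `|e k| <= geometric `|e 0%N| q k.
  rewrite /=; elim: k => [|k IH]; first by rewrite expr0 mulr1.
  by apply: le_trans (eq k) _; rewrite exprS mulrCA ler_wpM2l.
apply: (@squeeze_cvgr _ _ _ _ (cst 0) (geometric `|e 0%N| q)).
- by apply: nearW => k; rewrite normr_ge0 ek.
- exact: cvg_cst.
- by apply: cvg_geometric; rewrite ger0_norm.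
Qed.

Theorem proposition2 (R : realType) (U V : hilbertType R)
    (nontrivialU : exists u : U, u != 0) (nontrivialV : exists v : V, v != 0)
    (b : {bilinear U -> V -> R | *%R & *%R})
    (b_cont : form_continuous b) (b_inj : form_injective b)
    (b_surj : form_surjective b)
    (l : {scalar V}) (l_cont : continuous (l : V -> R))
    (ustar : U) (ustarP : forall v : V, b ustar v = l v)
    (B : U -> V) (BP : form_operator b B)
    (B' : V -> U) (B'P : form_adjoint_operator b B') :
  let normB := fine (opnorm B) in
  let normBinv := fine (opnorm (inverse B)) in
  (forall rho : R, 0 < rho -> rho < 2 * normB ^- 2 ->
     (opnorm (uzawa_operator B B' rho) < 1)%E /\
     forall (u0 : U) (u : U ^nat), uzawa_sequence b l rho u0 u ->
       u @ \oo --> ustar)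
  /\
  (let rhostar := 2 / (normB ^+ 2 + normBinv ^- 2) in
   (forall rho : R,
      minimizes_over_pos (fun rho => opnorm (uzawa_operator B B' rho)) rho
      <-> rho = rhostar) /\
   opnorm (uzawa_operator B B' rhostar)
     = ((normB ^+ 2 - normBinv ^- 2) / (normB ^+ 2 + normBinv ^- 2))%:E).
Proof.
move=> normB normBinv.
have [c c0 cB] := form_operator_upper b B BP b_cont.
have lower := form_operator_lower b B BP b_inj.
have Binj : injective B.
  have [c' c'0 c'B] := lower.
  move=> x y Bxy; apply/eqP; rewrite -subr_eq0 -normr_le0 -(pmulr_rle0 _ c'0).
  by apply: le_trans (c'B _) _; rewrite (form_operatorB b B BP) Bxy subrr normr0.
have Bfin : opnorm B \is a fin_num.
  by apply: (opnorm_fin_num B c) => // u _.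
have m0 : 0 < normBinv^-1.
  rewrite invr_gt0; exact: opnorm_inverse_gt0.
have m_lower := opnorm_inverse_lower B Binj nontrivialU nontrivialV lower.
have m_greatest := opnorm_inverse_greatest B Binj nontrivialU nontrivialV lower.
have M_upper u : `|B u| <= normB * `|u|.
  have [->|u0] := eqVneq u 0; last exact: norm_le_opnorm.
  by have := cB 0; rewrite !normr0 !mulr0.
have M_least c' : (forall u, u != 0 -> `|B u| <= c' * `|u|) -> normB <= c'.
  exact: fine_opnorm_le.
have mM := lower_le_upper B _ _ nontrivialU M_upper m_lower.
have M0 := lt_le_trans m0 mM.
have opnormE rho : 0 < rho -> opnorm (uzawa_operator B B' rho) =
    (Num.max (1 - rho * normBinv^-1 ^+ 2) (rho * normB ^+ 2 - 1))%:E.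
  move=> rho0; apply: (opnorm_gradient_step B) => // x y.
  exact: inner_uzawa_operator BP B'P _ _ _.
split=> [rho rho0 rhoM|].
  rewrite opnormE//; have rate1 := rate_lt1 _ _ m0 mM _ rho0 rhoM.
  split=> [|u0 u uP]; first by rewrite lte_fin.
  apply/subr_cvg0; set q := Num.max _ _ in rate1.
  have Tq x : `|uzawa_operator B B' rho x| <= q * `|x|.
    apply: (gradient_step_norm_le B) => // y z.
    exact: inner_uzawa_operator BP B'P _ _ _.
  (* At a nonzero x, q |x| dominates a norm, which forces the sign of q. *)
  have q0 : 0 <= q.
    have [x x0] := nontrivialU.
    by have := le_trans (normr_ge0 _) (Tq x); rewrite pmulr_lge0// normr_gt0.
  apply: (geometric_cvg0 _ q) => // k.
  by rewrite (uzawa_error b B B' BP B'P l rho ustar u0).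
(* Writes ||B^-1||^-2 as m^2, the shape used for the rate. *)
rewrite -exprVn => rhostar.
have rhostar0 : 0 < rhostar by exact: rhostar_gt0.
split=> [rho|]; last by rewrite opnormE// rate_rhostar.
split=> [[rho0 rho_min]|->].
  (* A minimizer other than [rhostar] would have a strictly larger rate than [rhostar], which is
     itself a competitor. *)
  apply/eqP/negPn/negP => /(rate_rhostar_lt _ _ m0 mM); apply/negP.
  by rewrite -leNgt -lee_fin -!opnormE// rho_min.
split=> // rho' rho'0; rewrite !opnormE// lee_fin.
have [->//|] := eqVneq rho' rhostar.
by move=> /(rate_rhostar_lt _ _ m0 mM)/ltW.
Qed.
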